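(* If $\bar X\in\mathbb{R}^{m\times n}$ is a lifted stationary point of the problem $\min_{X\in\mathbb{R}^{m\times n}} \mathcal F(X):=f(X)+\lambda\Phi(X)$, then for every $i\in\{1,\dots,n\}$, $$\sigma_i(\bar X)\in[0,\nu)\ \Longrightarrow\ \sigma_i(\bar X)=0.$$
   Context: Let $n\le m$ be positive integers. For $X\in\mathbb{R}^{m\times n}$, $\sigma(X)=(\sigma_1(X),\dots,\sigma_n(X))^T$ is the vector of singular values with $\sigma_1(X)\ge\dots\ge\sigma_n(X)\ge0$. For $x\in\mathbb{R}^n$, $\mathscr D(x)$ is the diagonal $m\times n$ matrix with diagonal $x$; $E_i=\mathscr D(e_i)$ with $e_i$ the $i$th standard unit vector. $\mathcal M(X)=\{(U,V): U\in\mathbb{R}^{m\times m},\,V\in\mathbb{R}^{n\times n}\text{ orthogonal},\ X=U\mathscr D(\sigma(X))V^T\}$. Standing assumptions: $\lambda>0$; $f:\mathbb{R}^{m\times n}\to[0,\infty)$ is convex (not necessarily smooth) and Lipschitz continuous with constant $L_f>0$ with respect to the Frobenius norm; the parameter $\nu$ satisfies $0<\nu<\bar\nu:=\lambda/L_f$. $\partial f$ is the subdifferential of $f$ (with respect to $\langle X,Y\rangle=\operatorname{tr}(XY^T)$). $\Phi(X)=\sum_{i=1}^n\phi(\sigma_i(X))$, where $\phi(t)=\min\{1,t/\nu\}$ for $t\ge0$. Let $\theta_1(t)=0$, $\theta_2(t)=t/\nu-1$ (so $\phi(t)=t/\nu-\max\{\theta_1(t),\theta_2(t)\}$) and $\mathcal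 D(t)=\{i\in\{1,2\}:\theta_i(t)=\max\{\theta_1(t),\theta_2(t)\}\}$. $X$ is a lifted stationary point of $\min \mathcal F$ if there exist $d_i\in\mathcal D(\sigma_i(X))$, $i=1,\dots,n$, such that $$\lambda\sum_{i=1}^n\theta_{d_i}'(\sigma_i(X))E_i\in\Big\{U^T\partial f(X)V+\tfrac{\lambda}{\nu}\mathscr D(\partial\|\sigma(X)\|_1):(U,V)\in\mathcal M(X)\Big\},$$ i.e. there are $(U,V)\in\mathcal M(X)$, $\xi\in\partial f(X)$ and $s\in\partial\|\cdot\|_1(\sigma(X))$ (the subdifferential of the $\ell_1$ norm on $\mathbb{R}^n$ at $\sigma(X)$) with $\lambda\sum_i\theta_{d_i}'(\sigma_i(X))E_i=U^T\xi V+\frac{\lambda}{\nu}\mathscr D(s)$. *)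

(* Defs.v *)
From mathcomp Require Import all_boot all_order all_algebra.
From mathcomp Require Import polyrcf.
From mathcomp Require Import all_classical all_reals all_analysis.

Set Implicit Arguments.
Unset Strict Implicit.
Unset Printing Implicit Defensive.

Import Order.TTheory GRing.Theory Num.Theory.
Import numFieldNormedType.Exports.

Local Open Scope classical_set_scope.
Local Open Scope ring_scope.

Section FrobeniusGeometry.
Variable R : realType.

(* Column vectors are the case q = 1, where this is the Euclidean product. *)
Definition mxdot (p q : nat) (X Y : 'M[R]_(p, q)) : R := \tr (X *m Y^T).

(* The norm of 'M[R]_(p, q) in MathComp-Analysis is the max norm, hence this
   separate definition. *)
Definition frobenius (p q : nat) (X : 'M[R]_(p, q)) : R :=
  Num.sqrt (mxdot X X).

Definition frobenius_lipschitz (p q : nat) (L : R) (f : 'M[R]_(p, q) -> R) :=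
  forall X Y, `|f X - f Y| <= L * frobenius (X - Y).

Definition subdifferential (p q : nat) (f : 'M[R]_(p, q) -> R)
    (X : 'M[R]_(p, q)) : set 'M[R]_(p, q) :=
  [set xi | forall Y, f X + mxdot xi (Y - X) <= f Y].

Definition l1norm (n : nat) (x : 'cV[R]_n) : R := \sum_i `|x i 0|.

Definition orthogonalmx (n : nat) (U : 'M[R]_n) := U^T *m U = 1%:M.

End FrobeniusGeometry.

Section SingularValues.
Variable R : realType.

(* Square roots of the eigenvalues of X^T X, repeated according to their
   algebraic multiplicity, in nonincreasing order. *)
Definition singular_values (m n : nat) (X : 'M[R]_(m, n)) : seq R :=
  let p := char_poly (X^T *m X) in
  sort >=%R (flatten [seq nseq (mup a p) (Num.sqrt a) | a <- rootsR p]).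

Definition sigma (m n : nat) (X : 'M[R]_(m, n)) : 'cV[R]_n :=
  \col_i (singular_values X)`_i.

Definition rdiag (m n : nat) (x : 'cV[R]_n) : 'M[R]_(m, n) :=
  \matrix_(i, j) (x j 0 *+ (i == j :> nat)).

Definition diag_unit (m n : nat) (i : 'I_n) : 'M[R]_(m, n) :=
  rdiag m (delta_mx i 0).

Definition svd_pairs (m n : nat) (X : 'M[R]_(m, n)) :
    set ('M[R]_m * 'M[R]_n) :=
  [set UV | [/\ orthogonalmx UV.1, orthogonalmx UV.2 &
                X = UV.1 *m rdiag m (sigma X) *m UV.2^T]].

Lemma rdiag_gram (m n : nat) (x : 'cV[R]_n) : (n <= m)%N ->
  (rdiag m x)^T *m rdiag m x = diag_mx (\row_i (x i 0) ^+ 2).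
Proof.
move=> nm; apply/matrixP => i j; rewrite !mxE.
rewrite (bigD1 (widen_ord nm i)) //= !mxE /= eqxx mulr1n big1 ?addr0.
  rewrite -val_eqE /=; case: eqP => [/val_inj ->|_]; first by rewrite expr2.
  by rewrite mulr0.
move=> k; rewrite -val_eqE /= !mxE => /negbTE ->; by rewrite mul0r.
Qed.

(* Any singular value decomposition determines sigma. *)
Lemma sigmaE (m n : nat) (X : 'M[R]_(m, n)) (U : 'M[R]_m) (V : 'M[R]_n)
    (x : 'cV[R]_n) : (n <= m)%N -> orthogonalmx U -> orthogonalmx V ->
  (forall i, 0 <= x i 0) -> (forall i j : 'I_n, (i <= j)%N -> x j 0 <= x i 0) ->
  X = U *m rdiag m x *m V^T -> sigma X = x.
Proof.
move=> nm oU oV x0 xs ->.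
pose s := [seq x i 0 | i <- enum 'I_n].
have szs : size s = n by rewrite size_map size_enum_ord.
have nths (i : 'I_n) : s`_i = x i 0.
  by rewrite (nth_map i) ?size_enum_ord // nth_ord_enum.
have s0 : {in s, forall a, 0 <= a} by move=> a /mapP[i _ ->].
have ss : sorted >=%R s.
  apply/(sortedP 0) => k; rewrite szs => kn.
  have kn' := ltnW kn.
  have := xs (Ordinal kn') (Ordinal kn) (leqnSn k).
  by rewrite -!nths.
set Y := U *m _ *m _.
have VT : V *m V^T = 1%:M by rewrite /orthogonalmx in oV; exact: mulmx1C.
have YY : Y^T *m Y = V *m diag_mx (\row_i (x i 0) ^+ 2) *m V^T.
  rewrite /Y !trmx_mul trmxK -(rdiag_gram x nm) !mulmxA.
  by rewrite -(mulmxA (V *m _) U^T) oU mulmx1.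
have charE : char_poly (Y^T *m Y) = \prod_(a <- [seq a ^+ 2 | a <- s]) ('X - a%:P).
  have <- : char_poly (diag_mx (\row_i (x i 0) ^+ 2)) =
            \prod_(a <- [seq a ^+ 2 | a <- s]) ('X - a%:P).
    rewrite char_poly_trig ?diag_mx_is_trig //.
    rewrite !big_map -[RHS]big_enum /= big_enum.
    by apply: eq_bigr => i _; rewrite !mxE eqxx mulr1n.
  rewrite YY /char_poly /char_poly_mx.
  have -> : 'X%:M - map_mx polyC (V *m diag_mx (\row_i x i 0 ^+ 2) *m V^T) =
     map_mx polyC V *m ('X%:M - map_mx polyC (diag_mx (\row_i x i 0 ^+ 2)))
       *m map_mx polyC V^T.
    rewrite mulmxBr mulmxBl -!map_mxM; congr (_ - _).
    by rewrite scalar_mxC -mulmxA -map_mxM VT map_mx1 mulmx1.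
  rewrite !det_mulmx mulrAC -det_mulmx -map_mxM VT map_mx1 det1.
  by rewrite mul1r.
have p0 : char_poly (Y^T *m Y) != 0 by rewrite monic_neq0 ?char_poly_monic.
suff svE : singular_values Y = s by apply/colP => i; rewrite mxE svE nths.
rewrite /singular_values.
apply: (sorted_eq (leT := >=%R)) => //.
- by move=> a b c /= ba ac; exact: le_trans ac ba.
- by move=> a b /andP[ab ba]; apply/le_anti/andP.
- by apply: sort_sorted => a b; exact: le_total.
rewrite perm_sort; apply/allP => /= a _; apply/eqP.
rewrite count_flatten -map_comp.
set p := char_poly _.
transitivity (\sum_(b <- rootsR p) (Num.sqrt b == a) * mup b p)%N.
  rewrite sumnE big_map; apply: eq_bigr => b _ /=.
  by rewrite count_nseq.
have mupE b : mup b p = count (fun c => c ^+ 2 == b) s.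
  by rewrite /p charE mu_prod_XsubC count_map.
have [a0|a0] := ltP a 0.
  rewrite big1 => [|b _]; last first.
    by case: eqP => // ba; move: a0; rewrite -ba ltNge sqrtr_ge0.
  apply/esym/count_memPn/negP => /s0.
  by rewrite leNgt a0.
have cE : count_mem a s = mup (a ^+ 2) p.
  rewrite mupE; apply: eq_in_count => b /s0 b0 /=.
  by rewrite eqrXn2.
rewrite cE.
have uR : uniq (rootsR p) by exact: uniq_roots.
have rP b : (b \in rootsR p) = root p b.
  by rewrite -(roots_on_rootsR p0 b) inE.
have [ra|nra] := boolP (a ^+ 2 \in rootsR p).
  rewrite (bigD1_seq (a ^+ 2)) //= sqrtr_sqr ger0_norm // eqxx mul1n.
  rewrite big1_seq ?addn0 // => b /andP[ba bR].
  case: eqP => // sb; case/negP: ba; rewrite -sb sqr_sqrtr //.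
  move: bR; rewrite rP -dvdp_XsubCl XsubC_dvd // mupE -has_count.
  move=> /hasP[c _ /eqP <-].
  exact: sqr_ge0.
rewrite [RHS]mupNroot -?rP // big1_seq // => b /andP[_ bR].
case: eqP => // sb; case/negP: nra; rewrite -sb sqr_sqrtr //.
move: bR; rewrite rP -dvdp_XsubCl XsubC_dvd // mupE -has_count.
  move=> /hasP[c _ /eqP <-].
exact: sqr_ge0.
Qed.

End SingularValues.

Section LiftedStationarity.
Variable R : realType.

Definition phi (nu t : R) : R := Num.min 1 (t / nu).

Definition Phi (nu : R) (m n : nat) (X : 'M[R]_(m, n)) : R :=
  \sum_i phi nu (sigma X i 0).

Definition objective (lambda nu : R) (m n : nat) (f : 'M[R]_(m, n) -> R)
    (X : 'M[R]_(m, n)) : R := f X + lambda * Phi nu X.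

(* The indices 0 and 1 of 'I_2 stand for the usual 1 and 2. *)
Definition theta (nu : R) (d : 'I_2) (t : R) : R :=
  if d == 0 then 0 else t / nu - 1.

Definition max_theta (nu t : R) : R := Num.max (theta nu 0 t) (theta nu 1 t).

Definition active (nu t : R) : {set 'I_2} :=
  [set d | theta nu d t == max_theta nu t].

Lemma phiE (nu t : R) : phi nu t = t / nu - max_theta nu t.
Proof.
rewrite /phi /max_theta /theta /= minElt maxElt subr_gt0.
by case: ifP => _; rewrite ?subr0 // opprB addrCA subrr addr0.
Qed.

(* X is a lifted stationary point of the minimization of objective lambda nu f.
   By phiE, this objective is f + lambda / nu * l1norm (sigma _) minus
   lambda times the sum of the values max_theta nu (sigma_i _). *)
Definition lifted_stationary (lambda nu : R) (m n : nat)
    (f : 'M[R]_(m, n) -> R) (X : 'M[R]_(m, n)) : Prop :=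
  exists2 d : 'I_n -> 'I_2, forall i, d i \in active nu (sigma X i 0) &
  exists (U : 'M[R]_m) (V : 'M[R]_n) (xi : 'M[R]_(m, n)) (s : 'cV[R]_n),
    [/\ svd_pairs X (U, V),
        subdifferential f X xi,
        subdifferential (@l1norm R n) (sigma X) s &
        lambda *: (\sum_i derive1 (theta nu (d i)) (sigma X i 0)
                             *: diag_unit R m i)
        = U^T *m xi *m V + (lambda / nu) *: rdiag m s].

End LiftedStationarity.

(* Main.v *)
Require Import Defs.
From mathcomp Require Import all_boot all_order all_algebra.
From mathcomp Require Import all_classical all_reals all_analysis.

Import Order.TTheory GRing.Theory Num.Theory.
Import numFieldNormedType.Exports.

Local Open Scope classical_set_scope.
Local Open Scope ring_scope.

(** Suppose that the singular value t of X with index i lies strictly between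
    0 and nu. Then the zero piece [theta nu 0] is the only active one at t
    ([active_lt]), so the left-hand side of the stationarity condition has a
    zero in its diagonal entry i. On the right-hand side the l1 subgradient
    satisfies s_i >= 1, because t > 0 ([subdifferential_l1norm_ge1]). Hence
    the diagonal entry i of U^T xi V is at most - lambda / nu, that is,
    - U E_i V^T is a direction of Frobenius norm 1 along which the subgradient
    xi of f has slope at least lambda / nu. The slope of a subgradient of an
    L-Lipschitz function along a unit direction is at most L
    ([subgradient_lipschitz]), so lambda / nu <= L, which is excluded by
    nu < lambda / L. *)

Lemma mxdot_mul (R : realType) (m n : nat) (U : 'M[R]_m) (V : 'M[R]_n)
    (A D : 'M[R]_(m, n)) :
  mxdot A (U *m D *m V^T) = mxdot (U^T *m A *m V) D.
Proof.
by rewrite /mxdot !trmx_mul trmxK !mulmxA mxtrace_mulC !mulmxA.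
Qed.

Lemma frobenius_mul_orthogonal (R : realType) (m n : nat) (U : 'M[R]_m)
    (V : 'M[R]_n) (D : 'M[R]_(m, n)) : orthogonalmx U -> orthogonalmx V ->
  frobenius (U *m D *m V^T) = frobenius D.
Proof.
move=> oU oV; congr Num.sqrt.
by rewrite mxdot_mul !mulmxA oU mul1mx -mulmxA oV mulmx1.
Qed.

Lemma frobeniusN (R : realType) (m n : nat) (D : 'M[R]_(m, n)) :
  frobenius (- D) = frobenius D.
Proof. by rewrite /frobenius /mxdot linearN /= mulmxN mulNmx opprK. Qed.

Lemma diag_unitE (R : realType) (m n : nat) (n_le_m : (n <= m)%N) (i : 'I_n) :
  diag_unit R m i = delta_mx (widen_ord n_le_m i) i.
Proof.
apply/matrixP => a b; rewrite !mxE eqxx andbT.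
have [->|_] := eqVneq b i; last by rewrite andbF mul0rn.
by rewrite andbT.
Qed.

Lemma mxdot_delta (R : realType) (m n : nat) (A : 'M[R]_(m, n)) k i :
  mxdot A (delta_mx k i) = A k i.
Proof.
rewrite /mxdot trmx_delta -[LHS]mxtrace_mulC /mxtrace (bigD1 i) //=.
rewrite big1 ?addr0 => [|j ji].
  rewrite mxE (bigD1 k) //= big1 ?addr0 => [|l lk]; rewrite mxE ?eqxx ?mul1r //.
  by rewrite (negPf lk) andbF mul0r.
by rewrite mxE big1 // => l _; rewrite mxE (negPf ji) mul0r.
Qed.

Lemma frobenius_delta (R : realType) (m n : nat) k i :
  frobenius (delta_mx k i : 'M[R]_(m, n)) = 1.
Proof. by rewrite /frobenius mxdot_delta mxE !eqxx sqrtr1. Qed.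

(** The subgradient inequality at X + D bounds the slope along D by the
    increment of f. *)
Lemma subgradient_lipschitz (R : realType) (p q : nat) (L : R)
    (f : 'M[R]_(p, q) -> R) (X xi D : 'M[R]_(p, q)) :
  frobenius_lipschitz L f -> subdifferential f X xi ->
  mxdot xi D <= L * frobenius D.
Proof.
move=> fL /(_ (X + D)); have := fL (X + D) X.
rewrite [X + D]addrC addrK -lerBrDl => fLD /le_trans; apply.
exact: le_trans (ler_norm _) fLD.
Qed.

(** Setting the positive coordinate x_i to 0 decreases the l1 norm by exactly
    x_i, while the subgradient inequality allows a decrease of at most
    s_i * x_i. *)
Lemma subdifferential_l1norm_ge1 (R : realType) (n : nat) (x s : 'cV[R]_n)
    (i : 'I_n) :
  subdifferential (@l1norm R n) x s -> 0 < x i 0 -> 1 <= s i 0.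
Proof.
move=> /(_ (x - x i 0 *: delta_mx i 0)) + xi_gt0.
rewrite addrAC subrr add0r -scaleN1r scalerA mulN1r.
rewrite [mxdot _ _](_ : _ = - (x i 0 * s i 0)); last first.
  by rewrite /mxdot linearZ /= -scalemxAr mxtraceZ [\tr _]mxdot_delta mulNr.
rewrite /l1norm (bigD1 i) //= [leRHS](bigD1 i) //= !mxE !eqxx mulr1 subrr normr0.
rewrite add0r [leRHS](eq_bigr (fun j => `|x j 0|)); last first.
  by move=> j /negPf ji; rewrite !mxE ji mulr0 addr0.
rewrite addrAC gerDr subr_le0 gtr0_norm //.
by rewrite ler_pMr.
Qed.

Lemma active_lt (R : realType) (nu t : R) (d : 'I_2) :
  0 < nu -> t < nu -> d \in active nu t -> d = 0.
Proof.
move=> nu_gt0 t_lt; have theta_lt : theta nu 1 t < theta nu 0 t.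
  by rewrite /theta /= subr_lt0 ltr_pdivrMr // mul1r.
rewrite inE /max_theta (max_idPl (ltW theta_lt)).
have [-> //|d_neq0] := eqVneq d 0.
have -> : d = 1 by case: d d_neq0 => [[|[|//]] ?] // _; apply/val_inj.
by rewrite lt_eqF.
Qed.

Theorem lemma2p4 (R : realType) (m n : nat) (n_gt0 : (0 < n)%N)
    (n_le_m : (n <= m)%N) (lambda L nu : R) (f : 'M[R]_(m, n) -> R)
    (lambda_gt0 : 0 < lambda) (f_ge0 : forall X, 0 <= f X)
    (f_convex : convex_function setT f)
    (L_gt0 : 0 < L) (f_lipschitz : frobenius_lipschitz L f)
    (nu_gt0 : 0 < nu) (nu_lt : nu < lambda / L)
    (X : 'M[R]_(m, n)) (X_stationary : lifted_stationary lambda nu f X) :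
  forall i : 'I_n, 0 <= sigma X i 0 < nu -> sigma X i 0 = 0.
Proof.
move=> i /andP[]; rewrite le_eqVlt => /orP[/eqP //|sigma_gt0 sigma_lt].
have [d d_active [U [V [xi [s]]]]] := X_stationary.
move=> [[/= oU oV _] f_xi l1_s stationary].
have s_ge1 : 1 <= s i 0 by exact: subdifferential_l1norm_ge1 l1_s sigma_gt0.
set k := widen_ord n_le_m i.
have entry : 0 = (U^T *m xi *m V) k i + lambda / nu * s i 0.
  have := congr1 (fun A : 'M[R]_(m, n) => A k i) stationary.
  rewrite /= mxE summxE (bigD1 i) //= big1 ?addr0 => [|j ji]; last first.
    by rewrite diag_unitE !mxE [i == j]eq_sym (negPf ji) andbF mulr0.
  rewrite (active_lt _ _ _ _ nu_gt0 sigma_lt (d_active i)).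
  have -> : theta nu 0 = cst 0 by [].
  by rewrite derive1_cst scale0r !mxE mulr0 eqxx mulr1n.
(* In the bases given by U and V, the singular direction i is U E_i V^T; the
   sign makes the slope of xi along it positive. *)
have slope_le : mxdot xi (U *m (- delta_mx k i) *m V^T) <= L.
  apply: le_trans (subgradient_lipschitz _ _ _ _ _ _ _ _ f_lipschitz f_xi) _.
  by rewrite frobenius_mul_orthogonal // frobeniusN frobenius_delta mulr1.
have slopeE : mxdot xi (U *m (- delta_mx k i) *m V^T) = lambda / nu * s i 0.
  rewrite mxdot_mul /mxdot linearN /= mulmxN linearN /= [\tr _]mxdot_delta.
  by apply/esym/eqP; rewrite -addr_eq0 addrC -entry.
have : lambda / nu <= L.
  apply: le_trans slope_le; rewrite slopeE ler_peMr // ltW //.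
  exact: divr_gt0.
by rewrite leNgt ltr_pdivlMr // mulrC -ltr_pdivlMr // nu_lt.
Qed.
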